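(* Let $\pi:(X,f_{1,\infty})\to(Y,g_{1,\infty})$ be a semiconjugacy between non-autonomous discrete dynamical systems. If $(X,f_{1,\infty})$ is topologically transitive, strongly transitive, very strongly transitive, exact transitive, strongly exact transitive, exact or locally eventually onto, then $(Y,g_{1,\infty})$ satisfies the corresponding property.
   Context: $\mathbb{N}=\{1,2,3,\dots\}$. A non-autonomous discrete dynamical system (NDDS) is a pair $(X,f_{1,\infty})$ where $X$ is a compact metric space and $f_{1,\infty}=(f_n)_{n\in\mathbb{N}}$ is a sequence of continuous maps $f_n:X\to X$; $f_1^n:=f_n\circ\cdots\circ f_1$. A semiconjugacy $\pi:(X,f_{1,\infty})\to(Y,g_{1,\infty})$ is a continuous surjection $\pi:X\to Y$ with $\pi\circ f_1^n=g_1^n\circ\pi$ for each $n\in\mathbb{N}$. ''Opene'' means nonempty and open. An NDDS $(X,f_{1,\infty})$ is: - topologically transitive if $\bigcup_{n=1}^\infty f_1^n(V)$ is dense in $X$ for every opene $V\subset X$; - strongly transitive if $\bigcup_{n=1}^\infty f_1^n(V)=X$ for every opene $V\subset X$; - very strongly transitive if for every opene $V\subset X$ there is $k\in\mathbb{N}$ with $\bigcup_{n=1}^k f_1^n(V)=X$; - exact transitive if $\bigcup_{n=1}^\infty(f_1^n(U)\cap f_1^n(V))$ is dense in $X$ for all opene $U,V\subset X$; - strongly exact transitive if $\bigcup_{n=1}^\infty(f_1^n(U)\cap f_1^n(V))=X$ for all opene $U,V\subset X$; - exact if for all opene $U,V\subset X$ there is $N\in\mathbb{N}$ with $f_1^N(U)\cap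 f_1^N(V)\neq\emptyset$; - locally eventually onto if for every opene $V\subset X$ there is $k\in\mathbb{N}$ with $f_1^k(V)=X$. *)

(* Defs.v *)
From HB Require Import structures.
From mathcomp Require Import all_boot all_order all_algebra.
From mathcomp Require Import all_classical all_reals all_analysis.

Set Implicit Arguments.
Unset Strict Implicit.
Unset Printing Implicit Defensive.

Local Open Scope classical_set_scope.

(* A sequence (f_n) indexed by n = 1, 2, 3, ... is encoded as f : nat -> X -> X
   where f n is f_n for n >= 1; the entry f 0 is never used. *)

(* f_1^n = f_n o ... o f_1 *)
Fixpoint ncomp (X : Type) (f : nat -> X -> X) (n : nat) : X -> X :=
  if n is m.+1 then f m.+1 \o ncomp f m else id.

Definition is_ndds (R : realType) (X : metricType R) (f : nat -> X -> X) : Prop :=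
  compact [set: X] /\ forall n : nat, (0 < n)%N -> continuous (f n).

Definition semiconjugacy (R : realType) (X Y : metricType R)
    (f : nat -> X -> X) (g : nat -> Y -> Y) (p : X -> Y) : Prop :=
  [/\ continuous p,
      set_surj [set: X] [set: Y] p
    & forall n : nat, (0 < n)%N -> p \o ncomp f n = ncomp g n \o p].

Definition opene (X : topologicalType) (V : set X) : Prop :=
  V !=set0 /\ open V.

Section Properties.
Context (R : realType) (X : metricType R) (f : nat -> X -> X).

Definition topologically_transitive : Prop :=
  forall V : set X, opene V ->
    dense (\bigcup_(n in [set n | (0 < n)%N]) (ncomp f n @` V)).

Definition strongly_transitive : Prop :=
  forall V : set X, opene V ->
    \bigcup_(n in [set n | (0 < n)%N]) (ncomp f n @` V) = [set: X].

Definition very_strongly_transitive : Prop :=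
  forall V : set X, opene V ->
    exists2 k : nat, (0 < k)%N &
      \bigcup_(n in [set n | (0 < n <= k)%N]) (ncomp f n @` V) = [set: X].

Definition exact_transitive : Prop :=
  forall U V : set X, opene U -> opene V ->
    dense (\bigcup_(n in [set n | (0 < n)%N])
             (ncomp f n @` U `&` ncomp f n @` V)).

Definition strongly_exact_transitive : Prop :=
  forall U V : set X, opene U -> opene V ->
    \bigcup_(n in [set n | (0 < n)%N])
      (ncomp f n @` U `&` ncomp f n @` V) = [set: X].

Definition exact_ndds : Prop :=
  forall U V : set X, opene U -> opene V ->
    exists2 N : nat, (0 < N)%N &
      ncomp f N @` U `&` ncomp f N @` V !=set0.

Definition locally_eventually_onto : Prop :=
  forall V : set X, opene V ->
    exists2 k : nat, (0 < k)%N & ncomp f k @` V = [set: X].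

End Properties.

(* Main.v *)
(* Since p o f_1^n = g_1^n o p, the map p sends f_1^n(p^-1(W)) into g_1^n(W).
   Each property of g for an opene W then follows from the property of f for
   the set p^-1(W), which is opene because p is continuous and surjective. *)
Require Import Defs.
From HB Require Import structures.
From mathcomp Require Import all_boot all_order all_algebra.
From mathcomp Require Import all_classical all_reals all_analysis.

Local Open Scope classical_set_scope.

Lemma opene_preimage (S T : topologicalType) (p : S -> T) (W : set T) :
  continuous p -> set_surj [set: S] [set: T] p ->
  opene W -> opene (p @^-1` W).
Proof.
move=> p_cont p_surj [[y Wy] W_open]; split.
  by have [x _ px] := p_surj y I; exists x; rewrite /preimage /= px.
by apply: open_comp W_open => x _; exact: p_cont.
Qed.

(** An opene [W] pulls back to an opene set, which meets [A]; [p] sends a common point into both [W]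
    and [B]. This transfers the properties that ask for a dense union. *)
Lemma dense_sub_preimage (S T : topologicalType) (p : S -> T)
    (A : set S) (B : set T) :
  continuous p -> set_surj [set: S] [set: T] p ->
  A `<=` p @^-1` B -> dense A -> dense B.
Proof.
move=> p_cont p_surj AB A_dense W W0 W_open.
have [W'0 W'_open] := opene_preimage _ _ _ _ p_cont p_surj (conj W0 W_open).
have [x [Wx Ax]] := A_dense _ W'0 W'_open.
by exists (p x); split => //; exact: AB.
Qed.

(** Every [y] is some [p x], and [x] lies in [A]. This transfers the properties that ask for the
    whole space. *)
Lemma surj_sub_preimage (S T : Type) (p : S -> T) (A : set S) (B : set T) :
  set_surj [set: S] [set: T] p ->
  A `<=` p @^-1` B -> A = [set: S] -> B = [set: T].
Proof.
move=> p_surj AB AT; apply/seteqP; split=> // y _.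
by have [x _ <-] := p_surj y I; apply: AB; rewrite AT.
Qed.

Lemma image_ncomp_preimage (S T : Type) (f : nat -> S -> S) (g : nat -> T -> T)
    (p : S -> T) (n : nat) (W : set T) :
  p \o ncomp f n = ncomp g n \o p ->
  ncomp f n @` (p @^-1` W) `<=` p @^-1` (ncomp g n @` W).
Proof.
move=> pfg _ [x Wx <-]; exists (p x) => //.
by have /= -> := congr1 (@^~ x) pfg.
Qed.

Theorem theorem3p12 (R : realType) (X Y : metricType R)
    (f : nat -> X -> X) (g : nat -> Y -> Y) (p : X -> Y)
    (hf : is_ndds f) (hg : is_ndds g) (hp : semiconjugacy f g p) :
  (topologically_transitive f -> topologically_transitive g) /\
  (strongly_transitive f -> strongly_transitive g) /\
  (very_strongly_transitive f -> very_strongly_transitive g) /\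
  (exact_transitive f -> exact_transitive g) /\
  (strongly_exact_transitive f -> strongly_exact_transitive g) /\
  (exact_ndds f -> exact_ndds g) /\
  (locally_eventually_onto f -> locally_eventually_onto g).
Proof.
case: hp => p_cont p_surj pfg.
have opp W : opene W -> opene (p @^-1` W) by exact: opene_preimage.
have img n W : (0 < n)%N ->
    ncomp f n @` (p @^-1` W) `<=` p @^-1` (ncomp g n @` W).
  by move=> n0; apply/image_ncomp_preimage/pfg.
(* One point [x] lies in both images at the same time [n], so the single point [p x] serves for [U]
   and [V] together. *)
have img2 n U V : (0 < n)%N ->
    ncomp f n @` (p @^-1` U) `&` ncomp f n @` (p @^-1` V) `<=`
    p @^-1` (ncomp g n @` U `&` ncomp g n @` V).
  by move=> n0 x [xU xV]; split; exact: img.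
do 6?split.
- move=> fP V /opp/fP; apply: dense_sub_preimage => // x [n n0 xV].
  by exists n => //; exact: img.
- move=> fP V /opp/fP fV; apply: (surj_sub_preimage _ _ _ _ _ p_surj _ fV) => x [n n0 xV].
  by exists n => //; exact: img.
(* The bound [k] found for the preimage of [V] also serves for [V], since [img] keeps the time [n]
   unchanged. *)
- move=> fP V /opp/fP[k k0 fV]; exists k => //.
  apply: (surj_sub_preimage _ _ _ _ _ p_surj _ fV) => x [n /= nk xV].
  by exists n => //; apply: img => //; case/andP: nk.
- move=> fP U V /opp oU /opp oV; move: (fP _ _ oU oV).
  apply: dense_sub_preimage => // x [n n0 xUV].
  by exists n => //; exact: img2.
- move=> fP U V /opp oU /opp oV; have fUV := fP _ _ oU oV.
  apply: (surj_sub_preimage _ _ _ _ _ p_surj _ fUV) => x [n n0 xUV].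
  by exists n => //; exact: img2.
- move=> fP U V /opp oU /opp oV; have [N N0 [x xUV]] := fP _ _ oU oV.
  (* Only one common point is required here, and [p x] is it. *)
  by exists N => //; exists (p x); exact: (img2 N U V N0 x xUV).
- move=> fP V /opp/fP[k k0 fV]; exists k => //.
  (* A single time [k] replaces the union, so [img] is already the required inclusion. *)
  by apply: (surj_sub_preimage _ _ _ _ _ p_surj _ fV); exact: img.
Qed.
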